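(* Let $\{\pi^k\}_{k\ge0}$ be generated by softmax policy gradient (softmax PG) with any constant step size $\eta_k=\eta>0$. Then for all $k\ge1$, $$V^*(\rho)-V^k(\rho)\le\frac1k\cdot\frac{1}{\tilde\rho\,(1-\gamma)^3}\cdot\frac{|\mathcal{A}|}{\kappa^2}\left(\max_s|\mathcal{A}_s^*|\right)^2\left(1+\frac{1-\gamma}{\eta\,\tilde\mu}\right).$$ In particular, if the optimal policy is unique (i.e. $|\mathcal{A}_s^*|=1$ for all $s$), then for all $k\ge1$, $$V^*(\rho)-V^k(\rho)\le\frac1k\cdot\frac{1}{(1-\gamma)^3}\cdot\frac{|\mathcal{A}|}{\kappa^2}\left\|\frac{d_\rho^*}{\rho}\right\|_\infty\left(1+\frac{1-\gamma}{\eta\,\tilde\mu}\right).$$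
   Context: MDP: a tuple $(\mathcal{S},\mathcal{A},P,r,\gamma)$ with finite state space $\mathcal{S}$, finite action space $\mathcal{A}$, transition probabilities $P(s'|s,a)$, reward $r:\mathcal{S}\times\mathcal{A}\to[0,1]$ and discount factor $\gamma\in[0,1)$. $\Delta(\mathcal{A})$, $\Delta(\mathcal{S})$ denote probability simplices; a policy is $\pi=(\pi(\cdot|s))_{s\in\mathcal{S}}$ with $\pi(\cdot|s)\in\Delta(\mathcal{A})$. Values: $V^\pi(s)=\mathbb{E}[\sum_{t\ge0}\gamma^t r(s_t,a_t)\mid s_0=s,\pi]$, $Q^\pi(s,a)=\mathbb{E}[\sum_{t\ge0}\gamma^t r(s_t,a_t)\mid s_0=s,a_0=a,\pi]$, $A^\pi=Q^\pi-V^\pi$, $V^\pi(\rho)=\mathbb{E}_{s\sim\rho}[V^\pi(s)]$. $V^*,Q^*$ are the optimal values, $A^*(s,a)=Q^*(s,a)-V^*(s)$, $\mathcal{A}_s^*=\arg\max_aA^*(s,a)$; an optimal policy is a policy whose state value is $V^*$. Visitation measure: $d_\rho^\pi(s)=(1-\gamma)\mathbb{E}[\sum_{t\ge0}\gamma^t\mathbf{1}\{s_t=s\}\mid s_0\sim\rho,\pi]$; $d_\rho^*=d_\rho^{\pi^*}$ for an optimal policy $\pi^*$. For policies $\pi^k$, write $V^k,A^k,d_\mu^k$ for $V^{\pi^k},A^{\pi^k},d_\mu^{\pi^k}$. Ratios of vectors are entrywise, $\|\cdot\|_\infty$ is the maximum absolute entry. Distributions: $\mu\in\Delta(\mathcal{S})$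 is fixed with $\tilde\mu=\min_s\mu(s)>0$; $\rho\in\Delta(\mathcal{S})$ is arbitrary with $\tilde\rho=\min_s\rho(s)>0$. Softmax PG: start from any softmax policy $\pi^0$ (so $\pi^0(a|s)\propto\exp(\theta^0_{s,a})$, all entries positive) and iterate $$\pi^{k+1}(a|s)=\frac{\pi^k(a|s)\exp\left(\eta_s^k\,\pi^k(a|s)A^k(s,a)\right)}{\sum_{a'}\pi^k(a'|s)\exp\left(\eta_s^k\,\pi^k(a'|s)A^k(s,a')\right)},\qquad \eta_s^k=\frac{\eta_k}{1-\gamma}d_\mu^k(s).$$ The constant $\kappa$: with $b_s^k=\sum_{a\notin\mathcal{A}_s^*}\pi^k(a|s)$, $\kappa=\inf_{k\ge0}\min_{s\in\mathcal{S}}(1-b_s^k)$, taken along the generated sequence (the paper notes that $\kappa>0$ because softmax PG converges globally). *)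

(* Defs.v *)
From HB Require Import structures.
From mathcomp Require Import all_boot all_order all_algebra.
From mathcomp Require Import all_classical all_reals all_analysis.
Set Implicit Arguments.
Unset Strict Implicit.
Unset Printing Implicit Defensive.
Import Order.TTheory GRing.Theory Num.Theory.
Import numFieldNormedType.Exports.

Local Open Scope classical_set_scope.
Local Open Scope ring_scope.

Definition is_dist (R : realType) (T : finType) (p : T -> R) : Prop :=
  (forall x, 0 <= p x) /\ \sum_x p x = 1.

(* The default value 1 is harmless: only used for functions with values <= 1
   on a nonempty type. *)
Definition min_entry (R : realType) (T : finType) (f : T -> R) : R :=
  \big[Num.min/1]_x f x.

Definition norm_oo (R : realType) (T : finType) (f : T -> R) : R :=
  \big[Num.max/0]_x `|f x|.

Record mdp (R : realType) (S A : finType) := MDP {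
  trans : S -> A -> S -> R;
  reward : S -> A -> R;
  discount : R;
  trans_dist : forall s a, is_dist (trans s a);
  reward_bounds : forall s a, 0 <= reward s a <= 1;
  discount_bounds : 0 <= discount < 1 }.

Definition is_policy (R : realType) (S A : finType) (pi : S -> A -> R) : Prop :=
  forall s, is_dist (pi s).

Section MDPTheory.
Variables (R : realType) (S A : finType) (M : mdp R S A).
Implicit Types (pi : S -> A -> R) (nu mu rho : S -> R) (g : S -> A -> R).

Local Notation gamma := (discount M).

(* Probability of the trajectory h = (s_0, a_0), (s_1, a_1), ... when
   s_0 ~ nu, a_t ~ pi(. | s_t) and s_(t+1) ~ P(. | s_t, a_t). *)
Fixpoint traj_prob pi nu (h : seq (S * A)) : R :=
  if h is (s, a) :: h' then nu s * pi s a * traj_prob pi (trans M s a) h'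
  else 1.

Definition disc_sum g n (h : n.-tuple (S * A)) : R :=
  \sum_(t < n) gamma ^+ t * g (tnth h t).1 (tnth h t).2.

(* E[\sum_(t >= 0) gamma^t g(s_t, a_t) | s_0 ~ nu, pi], the expectation of the
   infinite discounted sum being the limit of the expectations of its
   truncations (g is bounded and gamma < 1). *)
Definition disc_expect pi nu g : R :=
  limn (fun n => \sum_(h : n.-tuple (S * A)) traj_prob pi nu h * disc_sum g h).

Definition dirac_dist (s : S) : S -> R := fun x => (x == s)%:R.

Definition Vpi pi s : R := disc_expect pi (dirac_dist s) (reward M).

(* Given s_0 = s and a_0 = a, the rest of the trajectory starts from
   s_1 ~ P(. | s, a). *)
Definition Qpi pi s a : R :=
  limn (fun n => \sum_(h : n.-tuple (S * A))
    traj_prob pi (trans M s a) h * disc_sum (reward M) [tuple of (s, a) :: h]).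

Definition Api pi s a : R := Qpi pi s a - Vpi pi s.

Definition Vstar s : R := sup [set Vpi pi s | pi in @is_policy R S A].
Definition Qstar s a : R := sup [set Qpi pi s a | pi in @is_policy R S A].
Definition Astar s a : R := Qstar s a - Vstar s.

Definition opt_actions s : {set A} :=
  finset (fun a => [forall b, Astar s b <= Astar s a]).

Definition optimal_policy pi : Prop :=
  is_policy pi /\ forall s, Vpi pi s = Vstar s.

(* E_(s ~ rho)[v s], e.g. V^pi(rho) for v = V^pi. *)
Definition avg rho (v : S -> R) : R := \sum_s rho s * v s.

Definition visitation pi rho s : R :=
  (1 - gamma) * disc_expect pi rho (fun x _ => (x == s)%:R).

Definition softmax (theta : S -> A -> R) : S -> A -> R :=
  fun s a => expR (theta s a) / \sum_b expR (theta s b).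

Definition softmax_pg_step mu (eta : R) pi : S -> A -> R :=
  fun s a =>
    let eta_s := eta / (1 - gamma) * visitation pi mu s in
    pi s a * expR (eta_s * pi s a * Api pi s a) /
    \sum_b pi s b * expR (eta_s * pi s b * Api pi s b).

Definition generated_by_softmax_pg mu (eta : nat -> R)
    (pi : nat -> S -> A -> R) : Prop :=
  (exists theta0, pi 0%N = softmax theta0) /\
  forall k, pi k.+1 = softmax_pg_step mu (eta k) (pi k).

Definition subopt_mass pi s : R := \sum_(a | a \notin opt_actions s) pi s a.

Definition kappa (pi : nat -> S -> A -> R) : R :=
  inf (range (fun k => min_entry (fun s => 1 - subopt_mass (pi k) s))).

End MDPTheory.

(* Main.v *)
Require Import Defs.
From HB Require Import structures.
From mathcomp Require Import all_boot all_order all_algebra.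
From mathcomp Require Import all_classical all_reals all_analysis.
From mathcomp Require Import ring lra.
Import Order.TTheory GRing.Theory Num.Theory.
Import numFieldNormedType.Exports.
Set Implicit Arguments.
Unset Strict Implicit.
Unset Printing Implicit Defensive.
Local Open Scope ring_scope.

(* One update raises V^k(s) by at least K v^2 for every a with
   v = pi^k(a|s) A^k(s,a) >= 0, where 1 / K = 1 / (eta min mu) + 1 / (1 - gamma).
   Hence V^k increases to some V and pi^k A^k tends to 0.

   The bound has content only if kappa > 0 (x / 0 = 0), so global convergence is
   needed. If the limiting advantage of some a0 in some state were positive,
   consider the logits there. Their sum is constant, and every action either has
   a logit bounded below or eventually stays far enough below a0 that its
   decrease is at most 1/|A| of the increase of a0. So the logits of the first
   kind are bounded above, the probability of a0 is bounded away from 0, and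
   pi^k A^k cannot tend to 0. Thus V satisfies the Bellman optimality
   equation, V = V^*, the suboptimal mass tends to 0, and kappa > 0.

   For the rate, compare pi^k with an optimal policy: its restriction to the
   optimal actions, renormalised, in general, and pi^* itself, which coincides
   with this restriction, when the optimal actions are unique. The mean
   advantage x under it satisfies kappa x <= |A_s^*| max_a pi^k(a|s) A^k(s,a),
   so the gap E_k obeys E_k^2 <= D (E_k - E_(k+1)), whence E_k <= D / k. *)

(** * Policy evaluation *)

Lemma cvg_fin_sum (R : realType) (I : finType) (u : I -> nat -> R) (l : I -> R) :
  (forall i, (u i n @[n --> \oo] --> l i)%classic) ->
  ((\sum_i u i n) @[n --> \oo] --> \sum_i l i)%classic.
Proof.
move=> ul; apply: cvg_big => //.
exact: add_continuous.
Qed.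

Lemma big_tuple_pair_cons (R : nmodType) (S A : finType) n
    (F : n.+1.-tuple (S * A) -> R) :
  \sum_h F h = \sum_s \sum_a \sum_(h : n.-tuple (S * A)) F [tuple of (s, a) :: h].
Proof.
under [RHS]eq_bigr do rewrite pair_big.
rewrite pair_big /=.
rewrite (reindex (fun p : S * (A * n.-tuple (S * A)) => [tuple of (p.1, p.2.1) :: p.2.2])) //=.
exists (fun t => ((thead t).1, ((thead t).2, [tuple of behead t]))) => [[s [a h]]|t] _ /=.
  by congr (_, (_, _)); apply/val_inj.
by rewrite [RHS]tuple_eta; apply/val_inj; case: (thead t).
Qed.

(** * A minimum principle for discounted stochastic kernels *)

Section Kernel.
Variables (R : realType) (S : finType) (gamma : R) (K : S -> S -> R).
Hypothesis gamma01 : 0 <= gamma < 1.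
Hypothesis K_dist : forall s, is_dist (K s).

(** At a minimiser of [u] the average of [u] is at least its minimum, so the minimum is at least
    [gamma] times itself; as [gamma < 1] it cannot be negative. All comparisons of value functions
    below rest on this. *)
Lemma bellman_ge0 (u : S -> R) :
  (forall s, gamma * \sum_x K s x * u x <= u s) -> forall s, 0 <= u s.
Proof.
move=> hu s.
have [s0 _ min_s0] := @Order.TotalTheory.arg_minP _ R S s xpredT u isT.
apply: le_trans (min_s0 s isT).
have h1 : u s0 <= \sum_x K s0 x * u x.
  rewrite -[leLHS]mul1r -(K_dist s0).2 mulr_suml; apply: ler_sum => x _.
  by apply: ler_wpM2l; [exact: (K_dist s0).1 | exact: min_s0].
have h2 := hu s0.
move: gamma01 => /andP[g0 g1].
have h3 : gamma * u s0 <= u s0 by apply: le_trans h2; exact: ler_wpM2l.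
by rewrite -(pmulr_rge0 _ (_ : 0 < 1 - gamma)); lra.
Qed.

Lemma bellman_unique (g u v : S -> R) :
  (forall s, u s = g s + gamma * \sum_x K s x * u x) ->
  (forall s, v s = g s + gamma * \sum_x K s x * v x) -> u =1 v.
Proof.
have le (u' v' : S -> R) :
  (forall s, u' s = g s + gamma * \sum_x K s x * u' x) ->
  (forall s, v' s = g s + gamma * \sum_x K s x * v' x) -> forall s, u' s <= v' s.
  move=> hu hv s; rewrite -subr_ge0.
  apply: (@bellman_ge0 (fun s => v' s - u' s)) => {}s.
  rewrite (eq_bigr (fun x => K s x * v' x - K s x * u' x)) => [|x _]; last by rewrite mulrBr.
  by rewrite sumrB [v' s]hv [u' s]hu; lra.
by move=> hu hv s; apply/eqP; rewrite eq_le !le.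
Qed.
End Kernel.

(** * Truncated discounted sums and their limits *)

Section Policy.
Variables (R : realType) (S A : finType) (M : mdp R S A) (pi : S -> A -> R).
Hypothesis pi_policy : is_policy pi.
Local Notation gamma := (discount M).

Definition policy_kernel s x : R := \sum_a pi s a * trans M s a x.

Lemma policy_kernel_dist s : is_dist (policy_kernel s).
Proof.
split=> [x|].
  by apply: sumr_ge0 => a _; apply: mulr_ge0;
    [exact: (pi_policy s).1 | exact: (trans_dist M s a).1].
rewrite exchange_big /= -[RHS](pi_policy s).2; apply: eq_bigr => a _.
by rewrite -mulr_sumr (trans_dist M s a).2 mulr1.
Qed.

Lemma sum_policy_kernel s (u : S -> R) :
  \sum_x policy_kernel s x * u x = \sum_a pi s a * \sum_x trans M s a x * u x.
Proof.
under eq_bigr do rewrite mulr_suml.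
rewrite exchange_big /=; apply: eq_bigr => a _.
by rewrite mulr_sumr; apply: eq_bigr => x _; rewrite mulrA.
Qed.

Definition trunc_value (g : S -> A -> R) n (nu : S -> R) : R :=
  \sum_(h : n.-tuple (S * A)) traj_prob M pi nu h * disc_sum M g h.

Lemma disc_sum_cons (g : S -> A -> R) n x (h : n.-tuple (S * A)) :
  disc_sum M g [tuple of x :: h] = g x.1 x.2 + gamma * disc_sum M g h.
Proof.
rewrite /disc_sum big_ord_recl /= expr0 mul1r tnth0; congr (_ + _).
rewrite mulr_sumr; apply: eq_bigr => t _.
by rewrite tnthS exprS mulrA.
Qed.

Lemma traj_prob_sum1 n (nu : S -> R) : is_dist nu ->
  \sum_(h : n.-tuple (S * A)) traj_prob M pi nu h = 1.
Proof.
elim: n nu => [|n IH] nu nu_dist.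
  rewrite (big_pred1 [tuple]) // => h; rewrite [h]tuple0; exact/esym/eqxx.
rewrite big_tuple_pair_cons -[RHS]nu_dist.2 /=.
apply: eq_bigr => s _; rewrite -[RHS]mulr1 -(pi_policy s).2 mulr_sumr.
apply: eq_bigr => a _; rewrite -mulr_sumr IH ?mulr1 //; exact: trans_dist.
Qed.

Lemma trunc_value_cons (g : S -> A -> R) n nu s a : is_dist nu ->
  \sum_(h : n.-tuple (S * A)) traj_prob M pi nu h * disc_sum M g [tuple of (s, a) :: h] =
  g s a + gamma * trunc_value g n nu.
Proof.
move=> nu_dist.
under eq_bigr do rewrite disc_sum_cons mulrDr.
rewrite big_split /= -mulr_suml traj_prob_sum1 // mul1r; congr (_ + _).
by rewrite /trunc_value mulr_sumr; apply: eq_bigr => h _; rewrite mulrCA.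
Qed.

Lemma trunc_valueS (g : S -> A -> R) n nu :
  trunc_value g n.+1 nu =
  \sum_s nu s * \sum_a pi s a * (g s a + gamma * trunc_value g n (trans M s a)).
Proof.
rewrite /trunc_value big_tuple_pair_cons /=.
apply: eq_bigr => s _; rewrite mulr_sumr; apply: eq_bigr => a _.
rewrite -trunc_value_cons; last exact: trans_dist.
by rewrite !mulr_sumr; apply: eq_bigr => h _; rewrite !mulrA.
Qed.

Lemma sum_dirac (f : S -> R) s : \sum_x dirac_dist R s x * f x = f s.
Proof.
rewrite (bigD1 s) //= /dirac_dist eqxx mul1r big1 ?addr0 // => x /negPf ->.
by rewrite mul0r.
Qed.

(** Reduces every initial distribution to point masses, so convergence has to be proved only for
    those. *)
Lemma trunc_value_linear (g : S -> A -> R) n nu :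
  trunc_value g n nu = \sum_s nu s * trunc_value g n (dirac_dist R s).
Proof.
case: n => [|n].
  rewrite [RHS]big1 => [|s _]; rewrite /trunc_value ?big1 ?mulr0 // => h _;
  by rewrite /disc_sum big_ord0 mulr0.
rewrite trunc_valueS; apply: eq_bigr => s _; congr (_ * _).
by rewrite trunc_valueS sum_dirac.
Qed.

Section Value.
Variable g : S -> A -> R.
Hypothesis g01 : forall s a, 0 <= g s a <= 1.

Local Notation W n s := (trunc_value g n (dirac_dist R s)).

Let avg_ge0 s (f : A -> R) : (forall a, 0 <= f a) -> 0 <= \sum_a pi s a * f a.
Proof. by move=> f0; apply: sumr_ge0 => a _; apply: mulr_ge0 => //; exact: (pi_policy s).1. Qed.

Let W_rec n s : W n.+1 s = \sum_a pi s a * (g s a + gamma * \sum_x trans M s a x * W n x).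
Proof.
rewrite trunc_valueS sum_dirac; apply: eq_bigr => a _.
by rewrite trunc_value_linear.
Qed.

Let W_mono : forall s, nondecreasing_seq (fun n => W n s).
Proof.
move=> s; apply/nondecreasing_seqP => n; elim: n s => [|n IH] s.
  have -> : W 0 s = 0 by rewrite /trunc_value big1 // => h _; rewrite /disc_sum big_ord0 mulr0.
  rewrite W_rec; apply: avg_ge0 => a.
  rewrite big1 ?mulr0 ?addr0 => [|x _]; first by have /andP[] := g01 s a.
  by rewrite /trunc_value big1 ?mulr0 // => h _; rewrite /disc_sum big_ord0 mulr0.
rewrite !W_rec; apply: ler_sum => a _; apply: ler_wpM2l; first exact: (pi_policy s).1.
rewrite lerD2l; apply: ler_wpM2l; first by have /andP[] := discount_bounds M.
by apply: ler_sum => x _; apply: ler_wpM2l; [exact: (trans_dist M s a).1 | exact: IH].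
Qed.

Let W_ub n s : W n s <= (1 - gamma)^-1.
Proof.
have /andP[g0 g1] := discount_bounds M.
have c0 : 0 < 1 - gamma by lra.
elim: n s => [|n IH] s.
  by rewrite /trunc_value big1 ?invr_ge0 ?ltW // => h _; rewrite /disc_sum big_ord0 mulr0.
rewrite W_rec -[leRHS]mul1r -[X in _ <= X * _](pi_policy s).2 mulr_suml; apply: ler_sum => a _.
apply: ler_wpM2l; first exact: (pi_policy s).1.
(* The bound is the fixed point of [x = 1 + gamma * x], hence reproduces itself under the
   recursion. *)
have -> : (1 - gamma)^-1 = 1 + gamma * (1 - gamma)^-1 by field; lra.
apply: lerD; first by have /andP[] := g01 s a.
apply: ler_wpM2l => //.
rewrite -[leRHS]mul1r -[X in _ <= X * _](trans_dist M s a).2 mulr_suml; apply: ler_sum => x _.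
by apply: ler_wpM2l => //; exact: (trans_dist M s a).1.
Qed.

Definition value s : R := disc_expect M pi (dirac_dist R s) g.

Let W_cvg s : (W n s @[n --> \oo] --> value s)%classic.
Proof.
apply: nondecreasing_is_cvgn; first exact: W_mono.
by exists (1 - gamma)^-1 => _ [n _ <-]; exact: W_ub.
Qed.
Arguments W_cvg : clear implicits.

Lemma trunc_value_cvg nu : (trunc_value g n nu @[n --> \oo] --> \sum_s nu s * value s)%classic.
Proof.
under eq_fun do rewrite trunc_value_linear.
by apply: cvg_fin_sum => s; apply: cvgMr; exact: W_cvg.
Qed.

Lemma disc_expectE nu : disc_expect M pi nu g = \sum_s nu s * value s.
Proof. by apply/cvg_lim => //; exact: trunc_value_cvg. Qed.

Lemma value_bounds s : 0 <= value s <= (1 - gamma)^-1.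
Proof.
have cv : cvgn (fun n => W n s) by apply/cvg_ex; eexists; exact: W_cvg.
apply/andP; split; last by apply: limr_le => //; near=> n; exact: W_ub.
apply: limr_ge => //; near=> n.
apply: le_trans (W_mono s (leq0n n)).
by rewrite /trunc_value big1 // => h _; rewrite /disc_sum big_ord0 mulr0.
Unshelve. all: by end_near. Qed.

Lemma value_bellman s :
  value s = \sum_a pi s a * (g s a + gamma * \sum_x trans M s a x * value x).
Proof.
have h1 : (W n.+1 s @[n --> \oo] --> value s)%classic.
  by move: (W_cvg s); rewrite -cvg_shiftS.
have h2 : (W n.+1 s @[n --> \oo] -->
    \sum_a pi s a * (g s a + gamma * \sum_x trans M s a x * value x))%classic.
  under eq_cvg do rewrite W_rec.
  apply: cvg_fin_sum => a; apply: cvgMr; apply: cvgD; first exact: cvg_cst.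
  by apply: cvgMr; apply: cvg_fin_sum => x; apply: cvgMr; exact: W_cvg.
exact: (cvg_unique _ h1 h2).
Qed.

End Value.
End Policy.

Lemma ler_wsum_const (R : realType) (T : finType) (p f : T -> R) (m : R) :
  is_dist p -> (forall x, f x <= m) -> \sum_x p x * f x <= m.
Proof.
move=> [p0 p1] fm; rewrite -[leRHS]mul1r -[X in _ <= X * _]p1 mulr_suml.
by apply: ler_sum => x _; exact: ler_wpM2l.
Qed.

(** * Bellman equations, performance difference and visitation measures *)

Section PolicyFacts.
Variables (R : realType) (S A : finType) (M : mdp R S A).
Local Notation gamma := (discount M).
Implicit Types (pi : S -> A -> R) (u : S -> R).

Definition backup u s a : R := reward M s a + gamma * \sum_x trans M s a x * u x.

Lemma one_minus_discount_gt0 : 0 < 1 - gamma.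
Proof. by have /andP[g0 g1] := discount_bounds M; lra. Qed.

Lemma Vpi_bounds pi : is_policy pi -> forall s, 0 <= Vpi M pi s <= (1 - gamma)^-1.
Proof. by move=> pi_pol s; exact: value_bounds (reward_bounds M) s. Qed.

Lemma QpiE pi s a : is_policy pi -> Qpi M pi s a = backup (Vpi M pi) s a.
Proof.
move=> pi_pol; apply/cvg_lim => //.
under eq_cvg do rewrite (trunc_value_cons M pi_pol _ _ _ _ (trans_dist M s a)).
apply: cvgD; first exact: cvg_cst.
by apply: cvgMr; apply: trunc_value_cvg => //; exact: reward_bounds.
Qed.

Lemma Vpi_bellman pi s : is_policy pi ->
  Vpi M pi s = \sum_a pi s a * backup (Vpi M pi) s a.
Proof. by move=> pi_pol; exact: value_bellman (reward_bounds M) s. Qed.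

Lemma backup_le u v s a : (forall x, u x <= v x) -> backup u s a <= backup v s a.
Proof.
move=> uv; rewrite lerD2l; apply: ler_wpM2l; first by have /andP[] := discount_bounds M.
by apply: ler_sum => x _; apply: ler_wpM2l; [exact: (trans_dist M s a).1 | exact: uv].
Qed.

Lemma ApiE pi s a : is_policy pi -> Api M pi s a = backup (Vpi M pi) s a - Vpi M pi s.
Proof. by move=> pi_pol; rewrite /Api QpiE. Qed.

Lemma Api_bounds pi s a : is_policy pi -> `|Api M pi s a| <= (1 - gamma)^-1.
Proof.
move=> pi_pol; rewrite ApiE // ler_norml.
have /andP[v0 v1] := Vpi_bounds pi_pol s.
have /andP[g0 g1] := discount_bounds M.
have /andP[r0 r1] := reward_bounds M s a.
have c0 := one_minus_discount_gt0.
have b0 : 0 <= backup (Vpi M pi) s a.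
  rewrite addr_ge0 // mulr_ge0 // sumr_ge0 // => x _.
  rewrite mulr_ge0 ?(trans_dist M s a).1 //.
  by have /andP[] := Vpi_bounds pi_pol x.
have b1 : backup (Vpi M pi) s a <= (1 - gamma)^-1.
  have -> : (1 - gamma)^-1 = 1 + gamma * (1 - gamma)^-1 by field; lra.
  apply: lerD => //; apply: ler_wpM2l => //.
  apply: ler_wsum_const; first exact: trans_dist.
  by move=> x; have /andP[] := Vpi_bounds pi_pol x.
by lra.
Qed.

Lemma Api_mean0 pi s : is_policy pi -> \sum_a pi s a * Api M pi s a = 0.
Proof.
move=> pi_pol.
under eq_bigr do rewrite ApiE // mulrBr.
by rewrite sumrB -mulr_suml (pi_pol s).2 mul1r -Vpi_bellman // subrr.
Qed.

(** Stated for arbitrary [u] and [v], since it is applied both to values of policies and to the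
    limit of the values, which is not known to be the value of a policy. *)
Lemma backup_difference pi u v s : is_policy pi ->
  \sum_a pi s a * backup v s a - u s =
  \sum_a pi s a * (backup u s a - u s) +
  gamma * \sum_x policy_kernel M pi s x * (v x - u x).
Proof.
move=> pi_pol.
under [X in _ = X + _]eq_bigr do rewrite mulrBr.
rewrite sumrB -mulr_suml (pi_pol s).2 mul1r addrAC; congr (_ - _).
rewrite sum_policy_kernel mulr_sumr -big_split /=; apply: eq_bigr => a _.
rewrite mulrCA -mulrDr; congr (_ * _); rewrite /backup -addrA -mulrDr -big_split /=.
by congr (_ + _ * _); apply: eq_bigr => x _; ring.
Qed.

Lemma performance_difference pi pi' s : is_policy pi -> is_policy pi' ->
  Vpi M pi' s - Vpi M pi s = \sum_a pi' s a * Api M pi s a +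
    gamma * \sum_x policy_kernel M pi' s x * (Vpi M pi' x - Vpi M pi x).
Proof.
move=> pi_pol pi'_pol.
rewrite [Vpi M pi' s]Vpi_bellman // (@backup_difference pi' (Vpi M pi) (Vpi M pi')) //.
by congr (_ + _); apply: eq_bigr => a _; rewrite ApiE.
Qed.

Lemma policy_improvement pi pi' : is_policy pi -> is_policy pi' ->
  (forall s, 0 <= \sum_a pi' s a * Api M pi s a) ->
  forall s, \sum_a pi' s a * Api M pi s a <= Vpi M pi' s - Vpi M pi s.
Proof.
move=> pi_pol pi'_pol gain0 s.
have /andP[g0 _] := discount_bounds M.
have diff0 x : 0 <= Vpi M pi' x - Vpi M pi x.
  apply: (bellman_ge0 (discount_bounds M) (policy_kernel_dist M pi'_pol)
    (u := fun x => Vpi M pi' x - Vpi M pi x)) => y.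
  by rewrite [leRHS]performance_difference // lerDr.
rewrite [leRHS]performance_difference // lerDl mulr_ge0 // sumr_ge0 // => x _.
by rewrite mulr_ge0 // (policy_kernel_dist M pi'_pol s).1.
Qed.

Lemma indicator_bounds (s : S) (x : S) (a : A) :
  0 <= ((fun (y : S) (_ : A) => (y == s)%:R : R) x a) <= 1.
Proof. by rewrite ler0n lern1 leq_b1. Qed.

(** The unnormalised visitation of [s] as a function of the initial state; being a value function,
    it inherits the Bellman equation. *)
Definition occupancy pi s : S -> R := value M pi (fun x _ => (x == s)%:R).

Lemma visitationE pi nu s : is_policy pi ->
  visitation M pi nu s = (1 - gamma) * \sum_x nu x * occupancy pi s x.
Proof. by move=> pi_pol; rewrite /visitation disc_expectE //; exact: indicator_bounds. Qed.

Lemma occupancy_bounds pi s x : is_policy pi -> 0 <= occupancy pi s x <= (1 - gamma)^-1.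
Proof. by move=> pi_pol; exact: value_bounds (indicator_bounds s) x. Qed.

Lemma occupancy_bellman pi s x : is_policy pi ->
  occupancy pi s x = (x == s)%:R + gamma * \sum_y policy_kernel M pi x y * occupancy pi s y.
Proof.
move=> pi_pol; rewrite [LHS](value_bellman M pi_pol (indicator_bounds s)).
rewrite sum_policy_kernel.
under eq_bigr do rewrite mulrDr.
rewrite big_split /= -mulr_suml (pi_pol x).2 mul1r; congr (_ + _).
by rewrite mulr_sumr; apply: eq_bigr => a _; rewrite mulrCA.
Qed.

Lemma visitation_ge pi nu s : is_policy pi -> is_dist nu ->
  (1 - gamma) * nu s <= visitation M pi nu s.
Proof.
move=> pi_pol [nu0 _]; rewrite visitationE // ler_pM2l ?one_minus_discount_gt0 //.
rewrite (bigD1 s) //=.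
have occ0 x y : 0 <= occupancy pi x y by have /andP[] := occupancy_bounds x y pi_pol.
have occ1 : 1 <= occupancy pi s s.
  rewrite occupancy_bellman // eqxx lerDl mulr_ge0 //; first by have /andP[] := discount_bounds M.
  by apply: sumr_ge0 => y _; rewrite mulr_ge0 // (policy_kernel_dist M pi_pol s).1.
apply: ler_wpDr; first by apply: sumr_ge0 => x _; rewrite mulr_ge0.
by rewrite -[leLHS]mulr1; exact: ler_wpM2l.
Qed.

(* A solution of the evaluation equation of [pi] with state reward [h] is the
   discounted sum of [h] over the states visited by [pi]. *)
Lemma sum_visitation pi nu (u h : S -> R) : is_policy pi ->
  (forall x, u x = h x + gamma * \sum_y policy_kernel M pi x y * u y) ->
  (1 - gamma) * \sum_x nu x * u x = \sum_s visitation M pi nu s * h s.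
Proof.
move=> pi_pol hu.
(* The superposition of occupancies solves the same evaluation equation as [u], and the solution is
   unique. *)
have uE : u =1 (fun x => \sum_s h s * occupancy pi s x).
  apply: (bellman_unique (discount_bounds M) (policy_kernel_dist M pi_pol) (g := h)) => // x.
  under eq_bigr do rewrite occupancy_bellman // mulrDr.
  rewrite big_split /=; congr (_ + _).
    rewrite (bigD1 x) //= eqxx mulr1 big1 ?addr0 // => y; rewrite eq_sym => /negPf ->.
    by rewrite mulr0.
  under [in RHS]eq_bigr do rewrite mulr_sumr.
  rewrite exchange_big /= mulr_sumr; apply: eq_bigr => s _.
  rewrite mulrCA mulr_sumr; congr (_ * _); apply: eq_bigr => y _.
  by rewrite mulrCA.
under eq_bigr do rewrite uE mulr_sumr.
rewrite exchange_big /= mulr_sumr; apply: eq_bigr => s _.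
rewrite visitationE // -mulrA mulr_suml; congr (_ * _); apply: eq_bigr => x _.
by rewrite mulrCA mulrC.
Qed.

Lemma sum_visitation1 pi nu : is_policy pi -> is_dist nu -> \sum_s visitation M pi nu s = 1.
Proof.
move=> pi_pol [_ nu1]; have c0 := one_minus_discount_gt0.
(* The constant 1 solves the evaluation equation with constant reward [1 - gamma]. *)
have : (1 - gamma) * \sum_x nu x * 1 = \sum_s visitation M pi nu s * (1 - gamma).
  apply: sum_visitation => // x.
  under eq_bigr do rewrite mulr1.
  by rewrite (policy_kernel_dist M pi_pol x).2; ring.
rewrite -mulr_suml mulr1 nu1 -mulr_suml => /eqP.
by rewrite mulrC; rewrite eq_sym -subr_eq0 -mulrBl mulf_eq0 (gt_eqF c0) orbF subr_eq0 => /eqP.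
Qed.

Lemma visitation_ge0 pi nu s : is_policy pi -> is_dist nu -> 0 <= visitation M pi nu s.
Proof.
move=> pi_pol nu_dist; apply: le_trans (visitation_ge s pi_pol nu_dist).
by rewrite mulr_ge0 ?nu_dist.1 // ltW // one_minus_discount_gt0.
Qed.

End PolicyFacts.

(** * The update in one state *)

Lemma sum_expR_gt0 (R : realType) (A : finType) (f : A -> R) :
  (0 < #|A|)%N -> 0 < \sum_a expR (f a).
Proof.
move=> /card_gt0P[a _]; rewrite (bigD1 a) //= ltr_pwDl ?expR_gt0 // sumr_ge0 // => b _;
exact: expR_ge0.
Qed.

Lemma exists_ge0_of_mean0 (R : realType) (A : finType) (p f : A -> R) :
  (forall a, 0 < p a) -> \sum_a p a = 1 -> \sum_a p a * f a = 0 ->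
  exists a, 0 <= f a.
Proof.
move=> p_gt0 p_sum1 mean0; apply/not_existsP => no.
have neg a : p a * f a < 0 by rewrite pmulr_rlt0 // ltNge; apply/negP; exact: no.
have [m _] : exists a : A, True.
  apply/not_existsP => noA; have := p_sum1; rewrite big1 => [|a]; last by case: (noA a).
  by move/eqP; rewrite eq_sym oner_eq0.
have : \sum_a p a * f a < 0.
  rewrite (bigD1 m) //= -[ltRHS]addr0; apply: ltr_leD => //.
  by apply: sumr_le0 => b _; exact/ltW.
by rewrite mean0 ltxx.
Qed.

Section Tilt.
Variables (R : realType) (A : finType) (p adv : A -> R) (c c0 B : R).
Hypothesis p_gt0 : forall a, 0 < p a.
Hypothesis p_sum1 : \sum_a p a = 1.
Hypothesis adv_mean0 : \sum_a p a * adv a = 0.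
Hypothesis adv_ub : forall a, adv a <= B.
Hypothesis c0_gt0 : 0 < c0.
Hypothesis le_c0c : c0 <= c.

(** The update in a fixed state: [p] is the current policy there, [adv] its advantages, [c] the step
    size of the state. *)
Definition tilt a : R :=
  p a * expR (c * p a * adv a) / \sum_b p b * expR (c * p b * adv b).

(** With [v = p * adv] and weights [w = exp (c * v)], the gain is a sum of nonnegative terms over
    the normaliser [Z]. Keeping only the term of the largest [v] and using [Z <= w m] leaves a
    function of [v m] alone. *)
Lemma tilt_improvement a : 0 <= p a * adv a ->
  (p a * adv a) ^+ 2 <= (c0^-1 + B) * \sum_b tilt b * adv b.
Proof.
move=> va0.
have c_gt0 : 0 < c by exact: lt_le_trans le_c0c.
pose v b := p b * adv b.
have [m _ max_m] := @Order.TotalTheory.arg_maxP _ R A a xpredT v isT.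
have {}max_m b : v b <= v m by exact: max_m.
have vm0 : 0 <= v m by exact: le_trans (max_m a).
have p_le1 b : p b <= 1.
  rewrite -p_sum1 (bigD1 b) //= lerDl; apply: sumr_ge0 => x _; exact: ltW.
pose w b := expR (c * v b).
pose Z := \sum_b p b * w b.
have ZE : \sum_b p b * expR (c * p b * adv b) = Z.
  by apply: eq_bigr => b _; rewrite /w /v mulrA.
have Z_gt0 : 0 < Z.
  rewrite /Z (bigD1 m) //=; apply: ltr_pwDl; first by rewrite mulr_gt0 ?expR_gt0.
  by apply: sumr_ge0 => b _; rewrite mulr_ge0 ?expR_ge0 // ltW.
have Z_le : Z <= w m.
  rewrite /Z -[leRHS]mul1r -[X in _ <= X * _]p_sum1 mulr_suml; apply: ler_sum => b _.
  apply: ler_wpM2l; first exact: ltW.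
  by rewrite ler_expR; apply: ler_wpM2l => //; exact: ltW.
(* The weight may be lowered by 1 because the advantages have mean 0; then both factors of each term
   have the same sign. *)
have gainE : \sum_b tilt b * adv b = (\sum_b v b * (w b - 1)) / Z.
  under [X in _ = X / _]eq_bigr do rewrite mulrBr mulr1.
  rewrite sumrB [X in _ - X]adv_mean0 subr0 mulr_suml.
  by apply: eq_bigr => b _; rewrite /tilt ZE /w /v mulrA; ring.
have term_ge0 b : 0 <= v b * (w b - 1).
  have [vb0|vb0] := leP 0 (v b).
    apply: mulr_ge0 => //; rewrite subr_ge0 -[leLHS](@expR0 R) ler_expR.
    by apply: mulr_ge0 => //; exact: ltW.
  apply: mulr_le0; first exact: ltW.
  rewrite subr_le0 -[leRHS](@expR0 R) ler_expR.
  by apply: mulr_ge0_le0; exact: ltW.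
have gain_ge : v m * (w m - 1) / w m <= \sum_b tilt b * adv b.
  rewrite gainE; apply: ler_pM.
  - exact: term_ge0.
  - by rewrite invr_ge0 expR_ge0.
  - by rewrite (bigD1 m) //= lerDl sumr_ge0.
  - by rewrite lef_pV2 // posrE ?expR_gt0.
have w_ge : 1 + c * v m <= w m by exact: expR_ge1Dx.
have cv0 : 0 <= c * v m by rewrite mulr_ge0 // ltW.
have vB : v m <= B.
  have [am0|am0] := leP 0 (adv m).
    apply: le_trans (adv_ub m); rewrite -[leRHS]mul1r /v.
    exact: ler_wpM2r.
  have vm_le0 : v m <= 0 by rewrite /v nmulr_lle0 // ltW.
  apply: le_trans vm_le0 _.
  have [b b0] := exists_ge0_of_mean0 p_gt0 p_sum1 adv_mean0.
  exact: le_trans b0 (adv_ub b).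
have cv1 : 0 < 1 + c * v m by lra.
(* This is [1 + x <= exp x] passed through the increasing map [y -> 1 - 1 / y]. *)
have frac : c * v m / (1 + c * v m) <= (w m - 1) / w m.
  have wn0 : w m != 0 by rewrite gt_eqF ?expR_gt0.
  have -> : c * v m / (1 + c * v m) = 1 - (1 + c * v m)^-1 by field; lra.
  have -> : (w m - 1) / w m = 1 - (w m)^-1 by field.
  by rewrite lerD2l lerN2 lef_pV2 // posrE expR_gt0.
have key : (v m) ^+ 2 <= (c^-1 + v m) * (v m * (w m - 1) / w m).
  have -> : v m ^+ 2 = (c^-1 + v m) * (v m * (c * v m / (1 + c * v m))).
    by field; lra.
  rewrite -[v m * (w m - 1) / w m]mulrA; apply: ler_wpM2l; last exact: ler_wpM2l.
  by rewrite addr_ge0 // invr_ge0 ltW.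
have gain0 : 0 <= v m * (w m - 1) / w m.
  by rewrite mulr_ge0 ?term_ge0 // invr_ge0 expR_ge0.
apply: (@le_trans _ _ (v m ^+ 2)); first by rewrite ler_sqr ?nnegrE // max_m.
apply: le_trans key _; apply: ler_pM => //.
- by rewrite addr_ge0 // invr_ge0 ltW.
- by apply: lerD => //; rewrite lef_pV2 // posrE.
Qed.

Lemma tilt_gain_ge0 : 0 <= \sum_b tilt b * adv b.
Proof.
have [a adv0] := exists_ge0_of_mean0 p_gt0 p_sum1 adv_mean0.
have a0 : 0 <= p a * adv a by rewrite pmulr_rge0.
have := tilt_improvement a0.
have B0 : 0 <= B by exact: le_trans (adv_ub a).
have cB : 0 < c0^-1 + B by apply: ltr_pwDl => //; rewrite invr_gt0.
by move=> h; rewrite -(pmulr_rge0 _ cB); apply: le_trans h; exact: sqr_ge0.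
Qed.

End Tilt.

(** * Logits in one state and the sign of the limiting advantages *)

Section Logits.
Variables (R : realType) (A : finType).
Variables (theta p adv : nat -> A -> R) (c : nat -> R) (B : R) (L : A -> R).
Hypothesis pE : forall k a, p k a = expR (theta k a) / \sum_b expR (theta k b).
Hypothesis c_gt0 : forall k, 0 < c k.
Hypothesis thetaS : forall k a, theta k.+1 a = theta k a + c k * p k a * adv k a.
Hypothesis adv_mean0 : forall k, \sum_a p k a * adv k a = 0.
Hypothesis adv_bound : forall k a, `|adv k a| <= B.
Hypothesis adv_cvg : forall a, (adv k a @[k --> \oo] --> L a)%classic.
Hypothesis padv_cvg0 : forall a, (p k a * adv k a @[k --> \oo] --> 0)%classic.

Arguments adv_cvg : clear implicits.
Arguments padv_cvg0 : clear implicits.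

Let sum_gt0 k (a : A) : 0 < \sum_b expR (theta k b).
Proof. by apply: sum_expR_gt0; apply/card_gt0P; exists a. Qed.

Let p_gt0 k a : 0 < p k a.
Proof. by rewrite pE divr_gt0 ?expR_gt0 // sum_gt0. Qed.

Let p_sum1 k (a : A) : \sum_b p k b = 1.
Proof.
under eq_bigr do rewrite pE.
by rewrite -mulr_suml divff // gt_eqF // (sum_gt0 k a).
Qed.

Let p_le k a b x : theta k a <= theta k b + x -> p k a <= expR x * p k b.
Proof.
rewrite !pE mulrA; move=> h; apply: ler_wpM2r; first by rewrite invr_ge0; exact/ltW/(sum_gt0 k a).
by rewrite -expRD ler_expR addrC.
Qed.

Let sum_theta k : \sum_a theta k a = \sum_a theta 0%N a.
Proof.
elim: k => // k <-; under eq_bigr do rewrite thetaS.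
rewrite big_split /=; under [X in _ + X]eq_bigr do rewrite -mulrA.
by rewrite -mulr_sumr adv_mean0 mulr0 addr0.
Qed.

Section PositiveLimit.
Variable a0 : A.
Hypothesis La0 : 0 < L a0.

Local Notation n := (#|A|%:R : R).
Local Notation delta := (L a0 / 2).
Local Notation lam0 := (ln (delta / (n * B))).
(* If [theta k a <= theta k a0 + lam0], then [p k a * B <= p k a0 * delta / n]: even
   the worst advantage [-B] of [a] undoes at most 1/n of the increase of [a0]. *)
Definition margin a : R := if L a == 0 then 0 else lam0.

(** For [L a = 0] the margin 0 suffices: it gives [p k a <= p k a0], and the advantage of [a] is
    eventually at most [delta / n] in absolute value. *)
Definition low k a := theta k a <= theta k a0 + margin a.

Let n_ge1 : 1 <= n.
Proof. by rewrite ler1n; apply/card_gt0P; exists a0. Qed.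

Let n_gt0 : 0 < n. Proof. exact: lt_le_trans n_ge1. Qed.

Lemma eventually_signed : \forall k \near \oo%classic,
  delta <= adv k a0 /\ forall a,
   [/\ 0 < L a -> 0 <= adv k a, L a < 0 -> adv k a <= 0 &
       L a = 0 -> `|adv k a| <= delta / n].
Proof.
have dn : 0 < delta / n by rewrite !divr_gt0.
have La0' := La0; have dl : delta < L a0 by lra.
near=> k; split.
  near: k; exact: (cvgr_ge _ (adv_cvg a0)).
near: k; apply: filter_forall => a.
have [La|La|La] := ltgtP (L a) 0.
- apply: filterS (cvgr_le _ (adv_cvg a) _ La) => k hk; split => // La'.
  by move: La; rewrite La' ltxx.
- apply: filterS (cvgr_ge _ (adv_cvg a) _ La) => k hk; split => // La'.
  by move: La; rewrite La' ltxx.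
- have := adv_cvg a; rewrite La => /cvgr0_norm_le /(_ _ dn).
  by apply: filterS => k hk; split => //; rewrite ltxx.
Unshelve. all: by end_near. Qed.

Section FromTime.
Variable T : nat.
Hypothesis HT : forall k, (T <= k)%N -> delta <= adv k a0 /\ forall a,
   [/\ 0 < L a -> 0 <= adv k a, L a < 0 -> adv k a <= 0 &
       L a = 0 -> `|adv k a| <= delta / n].

Arguments HT : clear implicits.

Let B_ge : delta <= B.
Proof.
apply: le_trans (HT T (leqnn T)).1 _.
by apply: le_trans (adv_bound T a0); exact: ler_norm.
Qed.

Let delta_gt0 : 0 < delta. Proof. exact: divr_gt0. Qed.

Let B_gt0 : 0 < B. Proof. exact: lt_le_trans B_ge. Qed.

Let ratio_gt0 : 0 < delta / (n * B).
Proof. by rewrite divr_gt0 // mulr_gt0. Qed.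

Lemma margin_le0 a : margin a <= 0.
Proof.
rewrite /margin; case: eqP => // _; rewrite ln_le0 // ler_pdivrMr ?mul1r; last exact: mulr_gt0.
by apply: le_trans B_ge _; rewrite ler_peMl // ltW.
Qed.

Lemma low_p_le k a : low k a -> p k a <= p k a0.
Proof.
move=> /p_le /le_trans; apply; rewrite -[leRHS]mul1r; apply: ler_wpM2r; first exact/ltW.
by rewrite -[leRHS](@expR0 R) ler_expR margin_le0.
Qed.

(** The logit of [a0] grows at least as fast as that of [a]: either [a] has a negative limit and its
    logit does not grow, or both its probability and its advantage are dominated. *)
Lemma low_persists k a : (T <= k)%N -> L a <= 0 -> low k a -> low k.+1 a.
Proof.
move=> Tk La lowk; have [dk sgk] := HT k Tk; have [_ neg zer] := sgk a.
rewrite /low !thetaS.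
suff : p k a * adv k a <= p k a0 * adv k a0.
  by rewrite -(ler_pM2l (c_gt0 k)) !mulrA => h; move: lowk; rewrite /low; lra.
have pos : p k a0 * delta <= p k a0 * adv k a0 by rewrite ler_pM2l.
have pd : 0 <= p k a0 * delta by rewrite mulr_ge0 // ltW.
have [L0|L0] := eqVneq (L a) 0.
  have hn : adv k a <= delta.
    apply: le_trans (ler_norm _) _; apply: le_trans (zer L0) _.
    by rewrite ler_pdivrMr ?ler_peMr // ltW.
  apply: le_trans pos; apply: (@le_trans _ _ (p k a * delta)).
    by rewrite ler_pM2l.
  by rewrite ler_pM2r //; exact: low_p_le.
have Lneg : L a < 0 by rewrite lt_neqAle L0.
apply: le_trans pos; apply: le_trans pd.
by rewrite pmulr_rle0 //; exact: neg.
Qed.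

(** The decrease of [a] is small because its advantage is small if [L a = 0], and because its
    probability is small if [L a < 0]. *)
Lemma low_drift k a : (T <= k)%N -> L a <= 0 -> low k a ->
  - (p k a0 * adv k a0) <= n * (p k a * adv k a).
Proof.
move=> Tk La lowk; have [dk sgk] := HT k Tk; have [_ neg zer] := sgk a.
rewrite lerNl -mulrN; apply: (@le_trans _ _ (p k a0 * delta)); last by rewrite ler_pM2l.
have [L0|L0] := eqVneq (L a) 0.
  have hn : - adv k a <= delta / n.
    by apply: le_trans (zer L0); rewrite -normrN; exact: ler_norm.
  rewrite -mulrN mulrCA.
  apply: (@le_trans _ _ (p k a * delta)); last by rewrite ler_pM2r //; exact: low_p_le.
  by rewrite ler_pM2l // mulrC -ler_pdivlMr.
have advB : - adv k a <= B.
  by apply: le_trans (adv_bound k a); rewrite -normrN; exact: ler_norm.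
have pr : p k a <= delta / (n * B) * p k a0.
  by apply: le_trans (p_le lowk) _; rewrite /margin (negPf L0) lnK.
apply: (@le_trans _ _ (n * (p k a * B))).
  by rewrite -mulrN ler_pM2l ?ler_pM2l.
apply: (@le_trans _ _ (n * (delta / (n * B) * p k a0 * B))).
  by rewrite ler_pM2l ?ler_pM2r.
rewrite le_eqVlt; apply/orP; left; apply/eqP; field.
by rewrite !gt_eqF.
Qed.

(** One occurrence after [T] is enough, since being low persists from then on. *)
Definition eventually_low : {set A} :=
  [set a | (L a <= 0) && `[< exists k, (T <= k)%N /\ low k a >]].

Lemma eventually_lowP : exists T1, (T <= T1)%N /\
  forall k a, (T1 <= k)%N -> a \in eventually_low -> low k a.
Proof.
have step a : exists Ta, forall k, (Ta <= k)%N -> a \in eventually_low -> low k a.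
  have [|/negP na] := boolP (a \in eventually_low); last by exists 0%N.
  rewrite inE => /andP[La /asboolP[Ta [TTa lowa]]]; exists Ta => k + _.
  elim: k => [|k IH]; first by rewrite leqn0 => /eqP <-.
  rewrite leq_eqVlt => /orP[/eqP <- //|]; rewrite ltnS => Tak.
  by apply: low_persists => //; [exact: leq_trans Tak | exact: IH].
have [f fP] := choice step.
exists (maxn T (\max_a f a)); split; first exact: leq_maxl.
move=> k a; rewrite geq_max => /andP[_ fk]; apply: fP.
exact: leq_trans (leq_bigmax a) fk.
Qed.

(** If [L a > 0], the logit does not decrease after [T]. Otherwise [a] is never low, so it stays
    above the logit of [a0] plus the margin, and the logit of [a0] does not decrease. *)
Lemma off_low_bounded_below : exists m, forall k a, (T <= k)%N ->
  a \notin eventually_low -> m <= theta k a.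
Proof.
(* One bound for all actions: each sum lies below each of its single counterparts because the
   margins are nonpositive. *)
pose m := - (\sum_a `|theta T a|) + \sum_a margin a; exists m => k a Tk.
have thT b : - (\sum_a `|theta T a|) <= theta T b.
  rewrite lerNl (bigD1 b) //=; apply: le_trans (ler_norm _) _.
  by rewrite normrN lerDl sumr_ge0.
have sm0 : \sum_a margin a <= 0 by apply: sumr_le0 => b _; exact: margin_le0.
have smle b : \sum_a margin a <= margin b.
  by rewrite (bigD1 b) //= gerDl; apply: sumr_le0 => x _; exact: margin_le0.
have incr b : (forall j, (T <= j)%N -> 0 <= adv j b) -> theta T b <= theta k b.
  move=> pos; elim: k Tk => [|k IH]; first by rewrite leqn0 => /eqP ->.
  rewrite leq_eqVlt => /orP[/eqP <- //|]; rewrite ltnS => Tk.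
  apply: le_trans (IH Tk) _; rewrite thetaS lerDl mulr_ge0 ?pos //.
  by rewrite mulr_ge0 // ltW.
rewrite inE negb_and -ltNge => /orP[Lpos|/asboolPn no].
  have : theta T a <= theta k a.
    by apply: incr => j Tj; have [/(_ Lpos)] := (HT j Tj).2 a.
  by have := thT a; rewrite /m; lra.
have nlow : ~ low k a by move=> h; apply: no; exists k.
move/negP: nlow; rewrite -ltNge => nlow.
have : theta T a0 <= theta k a0.
  by apply: incr => j Tj; apply: le_trans (HT j Tj).1; exact: ltW.
by have := thT a0; have := smle a; rewrite /m; lra.
Qed.

Let a0_notin : a0 \notin eventually_low.
Proof. by rewrite inE leNgt La0. Qed.

(** At most [n] actions are low, and each loses at most [1 / n] of what [a0] gains. *)
Lemma low_mass_nondecreasing T1 : (T <= T1)%N ->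
  (forall k a, (T1 <= k)%N -> a \in eventually_low -> low k a) ->
  forall k, (T1 <= k)%N ->
  theta T1 a0 + \sum_(a in eventually_low) theta T1 a <=
  theta k a0 + \sum_(a in eventually_low) theta k a.
Proof.
move=> TT1 lowT1; elim=> [|k IH]; first by rewrite leqn0 => /eqP ->.
rewrite leq_eqVlt => /orP[/eqP <- //|]; rewrite ltnS => T1k.
apply: le_trans (IH T1k) _.
under [X in _ <= _ + X]eq_bigr do rewrite thetaS -mulrA.
rewrite thetaS big_split /= -mulr_sumr -mulrA.
suff : 0 <= p k a0 * adv k a0 + \sum_(a in eventually_low) p k a * adv k a.
  by move/(mulr_ge0 (ltW (c_gt0 k))); rewrite mulrDr; lra.
have Tk := leq_trans TT1 T1k.
have g0 : 0 <= p k a0 * adv k a0.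
  by rewrite pmulr_rge0 //; apply: le_trans (HT k Tk).1; exact: ltW.
rewrite -(pmulr_rge0 _ n_gt0) mulrDr mulr_sumr.
have : \sum_(a in eventually_low) - (p k a0 * adv k a0) <=
       \sum_(a in eventually_low) n * (p k a * adv k a).
  apply: ler_sum => a aJ; apply: low_drift => //; last exact: lowT1.
  by move: aJ; rewrite inE => /andP[].
rewrite sumr_const -mulr_natl.
have : #|eventually_low|%:R * (p k a0 * adv k a0) <= n * (p k a0 * adv k a0).
  by apply: ler_wpM2r => //; rewrite ler_nat max_card.
lra.
Qed.

Lemma logit_gap_bounded : exists U T1, (T <= T1)%N /\
  forall k a, (T1 <= k)%N -> theta k a <= theta k a0 + U.
Proof.
have [T1 [TT1 lowT1]] := eventually_lowP.
have [m mP] := off_low_bounded_below.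
pose G := theta T1 a0 + \sum_(a in eventually_low) theta T1 a.
pose rest a := (a \notin eventually_low) && (a != a0).
pose C := \sum_a theta 0%N a.
(* What the constant total [C] leaves for one remaining logit above [m], when [a0] and the low
   actions hold at least [G] and the others at least [m] each. The absolute value also covers low
   actions and [a0] itself. *)
pose U := C - G - \sum_(a | rest a) m.
exists `|U|, T1; split => // k a T1k.
have Tk := leq_trans TT1 T1k.
have U0 : 0 <= `|U| by [].
have [aJ|aJ] := boolP (a \in eventually_low).
  by have := lowT1 k a T1k aJ; have := margin_le0 a; rewrite /low; lra.
have [->|aa0] := eqVneq a a0; first by lra.
have ra : rest a by rewrite /rest aJ.
have split_sum : theta k a0 + \sum_(b in eventually_low) theta k b
    + \sum_(b | rest b) theta k b = C.
  rewrite /C -(sum_theta k) [RHS](bigID (mem eventually_low)) /= [theta k a0 + _]addrC -addrA.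
  by congr (_ + _); rewrite [RHS](bigD1 a0).
have mono := low_mass_nondecreasing TT1 lowT1 T1k.
have single : theta k a - m <= \sum_(b | rest b) (theta k b - m).
  rewrite (bigD1 a) //= lerDl; apply: sumr_ge0 => b /andP[/andP[bJ _] _].
  by rewrite subr_ge0; exact: mP.
move: single; rewrite sumrB => single.
have := mP k a0 Tk a0_notin; have := ler_norm U; rewrite {1}/U /G.
lra.
Qed.

End FromTime.
End PositiveLimit.

Lemma adv_limit_le0 a : L a <= 0.
Proof.
rewrite leNgt; apply/negP => La.
have [T _ HT] := eventually_signed La.
have [U [T1 [TT1 gap]]] := logit_gap_bounded La HT.
(* All probabilities are at most [expR U * p k a] and they sum to 1, so [p k a] is at least [q]. *)
pose q := (#|A|%:R * expR U)^-1.
have n0 : 0 < #|A|%:R :> R by rewrite ltr0n; apply/card_gt0P; exists a.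
have q0 : 0 < q by rewrite invr_gt0 mulr_gt0 ?expR_gt0.
have pq k : (T1 <= k)%N -> q <= p k a.
  move=> T1k; rewrite /q -div1r ler_pdivrMr ?mulr_gt0 ?expR_gt0 // -{1}(p_sum1 k a).
  rewrite [leRHS]mulrC -mulrA mulr_natl -sumr_const; apply: ler_sum => b _.
  exact/p_le/gap.
have : q * (L a / 2) <= 0.
  apply: (cvgr_to_ge (padv_cvg0 a)); exists T1 => // k T1k /=.
  apply: ler_pM; [exact: ltW | lra | exact: pq |].
  exact: (HT k (leq_trans TT1 T1k)).1.
by rewrite pmulr_rle0 //; lra.
Qed.

End Logits.

(** * The sequence generated by softmax policy gradient *)

(** Identifies the suprema in [Vstar] and [Qstar] with limits along the iterates, without exhibiting
    a maximising policy. *)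
Lemma sup_eq_limit (R : realType) (E : set R) (u : nat -> R) (l : R) :
  (forall x, E x -> x <= l) -> (forall n, E (u n)) ->
  (u n @[n --> \oo] --> l)%classic -> sup E = l.
Proof.
move=> ub uE ul; apply/eqP; rewrite eq_le; apply/andP; split.
  by apply: ge_sup => //; exists (u 0%N).
apply: (cvgr_to_le ul); near=> n; apply: ub_le_sup => //; by exists l.
Unshelve. all: by end_near. Qed.

Lemma sqr_avg_le (R : realType) (T : finType) (p f : T -> R) :
  is_dist p -> (\sum_x p x * f x) ^+ 2 <= \sum_x p x * f x ^+ 2.
Proof.
move=> [p0 p1]; set m := \sum_x p x * f x.
rewrite -subr_ge0.
(* The difference is the variance of [f] under [p]. *)
have -> : \sum_x p x * f x ^+ 2 - m ^+ 2 = \sum_x p x * (f x - m) ^+ 2.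
  have -> : \sum_x p x * (f x - m) ^+ 2 =
    \sum_x (p x * f x ^+ 2 + (m ^+ 2 * p x - (2 * m) * (p x * f x))).
    by apply: eq_bigr => x _; ring.
  by rewrite big_split sumrB /= -!mulr_sumr p1 -/m; ring.
by apply: sumr_ge0 => x _; rewrite mulr_ge0 ?sqr_ge0.
Qed.

Lemma quadratic_recursion_rate (R : realType) (E : nat -> R) (D : R) : 0 < D ->
  (forall k, E k ^+ 2 <= D * (E k - E k.+1)) ->
  forall k, (0 < k)%N -> E k <= D / k%:R.
Proof.
move=> D0 rec k k0.
rewrite ler_pdivlMr ?ltr0n // mulrC; case: k k0 => // k _.
(* The induction starts at index 1: one use of the recursion bounds [E 1] by [D] whatever the size
   of [E 0]. *)
elim: k => [|k IH].
  rewrite mul1r -(ler_pM2l D0).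
  have := rec 0%N; have := sqr_ge0 (E 0%N - D); have := sqr_ge0 (E 0%N).
  nra.
rewrite -(ler_pM2l D0) [_.+2%:R]mulrSr; move: IH (rec k.+1).
have n1 : 1 <= k.+1%:R :> R by rewrite ler1n.
move: (k.+1%:R) n1 (E k.+1) (E k.+2) => n n1 e e' ne re.
have eD : e <= D.
  by have [e0|e0] := leP e 0; [exact: le_trans e0 (ltW D0) | nra].
(* This expression equals [D ^+ 2 - (n + 1) * (D * e - e ^+ 2)], and the recursion gives
   [D * e' <= D * e - e ^+ 2]. *)
have h : 0 <= (D - e) * (D - n * e) + e ^+ 2.
  by rewrite addr_ge0 ?sqr_ge0 // mulr_ge0 // subr_ge0.
have h2 : (n + 1) * e ^+ 2 <= (n + 1) * (D * (e - e')) by rewrite ler_pM2l //; lra.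
nra.
Qed.

Lemma dist_on_singleton (R : realType) (T : finType) (p : T -> R) x :
  is_dist p -> (forall y, y != x -> p y = 0) -> p x = 1.
Proof. by move=> [_ <-] p0; rewrite (bigD1 x) //= big1 ?addr0. Qed.

Section Softmax.
Variables (R : realType) (S A : finType) (theta : S -> A -> R).

Lemma softmax_gt0 s a : 0 < softmax theta s a.
Proof. by rewrite divr_gt0 ?expR_gt0 // sum_expR_gt0 //; apply/card_gt0P; exists a. Qed.

Lemma softmax_policy : (0 < #|A|)%N -> is_policy (softmax theta).
Proof.
move=> hA s; split=> [a|]; first exact/ltW/softmax_gt0.
by rewrite -mulr_suml divff // gt_eqF // sum_expR_gt0.
Qed.

(** The multiplicative update of probabilities is additive on logits, as the old normaliser
    cancels. *)
Lemma tilt_softmax s (adv : A -> R) c a :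
  tilt (softmax theta s) adv c a =
  softmax (fun s a => theta s a + c * softmax theta s a * adv a) s a.
Proof.
have Z0 : \sum_b expR (theta s b) != 0.
  by rewrite gt_eqF // sum_expR_gt0 //; apply/card_gt0P; exists a.
rewrite /tilt [RHS]/softmax.
have pE b : softmax theta s b * expR (c * softmax theta s b * adv b) =
   expR (theta s b + c * softmax theta s b * adv b) / \sum_b expR (theta s b).
  by rewrite expRD {1}/softmax mulrAC.
under [X in _ / X]eq_bigr do rewrite pE.
rewrite pE -mulr_suml invfM invrK mulrACA mulVf ?mulr1 //.
Qed.
End Softmax.

(** * Monotone improvement along the iterates *)

Section Sequence.
Variables (R : realType) (S A : finType) (M : mdp R S A) (mu : S -> R) (eta : R).
Variable pi : nat -> S -> A -> R.
Hypothesis A_gt0 : (0 < #|A|)%N.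
Hypothesis mu_dist : is_dist mu.
Hypothesis mu_min : 0 < min_entry mu.
Hypothesis eta_gt0 : 0 < eta.
Hypothesis pi_pg : generated_by_softmax_pg M mu (fun=> eta) pi.

Local Notation gamma := (discount M).
Local Notation V k := (Vpi M (pi k)).
Local Notation adv k := (Api M (pi k)).
Local Notation step_size k s := (eta / (1 - gamma) * visitation M (pi k) mu s).

Lemma pi_logits : exists theta : nat -> S -> A -> R,
  (forall k, pi k = softmax (theta k)) /\
  forall k s a, theta k.+1 s a = theta k s a + step_size k s * pi k s a * adv k s a.
Proof.
have [[theta0 pi0] piS] := pi_pg.
pose theta := fix theta k := if k is j.+1 then
  fun s a => theta j s a + step_size j s * pi j s a * adv j s a else theta0.
exists theta; split=> //; elim=> [//|k IH].
apply/funext => s; apply/funext => a; rewrite piS.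
transitivity (tilt (pi k s) (adv k s) (step_size k s) a); first by [].
by rewrite {1}IH tilt_softmax -IH.
Qed.

Lemma pi_gt0 k s a : 0 < pi k s a.
Proof. by have [theta [-> _]] := pi_logits; exact: softmax_gt0. Qed.

Lemma pi_policy k : is_policy (pi k).
Proof. by have [theta [-> _]] := pi_logits; exact: softmax_policy. Qed.
Local Hint Resolve pi_policy : core.

(** The visitation is at least [(1 - gamma) * mu s], and the factor [1 - gamma] cancels; the bound
    is uniform in [k] and [s]. *)
Lemma le_step_size k s : eta * min_entry mu <= step_size k s.
Proof.
have c0 := one_minus_discount_gt0 M.
rewrite -mulrA ler_pM2l // ler_pdivlMl //.
apply: le_trans (visitation_ge M _ (pi_policy k) mu_dist).
by rewrite ler_pM2l //; exact: bigmin_le.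
Qed.

(** The constant [c0^-1 + B] of [tilt_improvement], for the lower bound on the step sizes and the
    bound on the advantages. *)
Definition improvement_cost : R := (eta * min_entry mu)^-1 + (1 - gamma)^-1.

Lemma improvement_cost_gt0 : 0 < improvement_cost.
Proof. by rewrite addr_gt0 ?invr_gt0 ?mulr_gt0 ?one_minus_discount_gt0. Qed.

Lemma one_step_improvement k s a : 0 <= pi k s a * adv k s a ->
  (pi k s a * adv k s a) ^+ 2 <= improvement_cost * (V k.+1 s - V k s).
Proof.
have piE s' b : pi k.+1 s' b = tilt (pi k s') (adv k s') (step_size k s') b.
  by have [_ ->] := pi_pg.
have ub s' b : adv k s' b <= (1 - gamma)^-1.
  exact: le_trans (ler_norm _) (Api_bounds M _ _ (pi_policy k)).
have c0 : 0 < eta * min_entry mu by rewrite mulr_gt0.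
(* Policy improvement at [s] needs a nonnegative gain in every state. *)
have gain0 s' : 0 <= \sum_b pi k.+1 s' b * adv k s' b.
  under eq_bigr do rewrite piE.
  exact: (tilt_gain_ge0 (pi_gt0 k s') (pi_policy k s').2
    (Api_mean0 M _ (pi_policy k)) (ub s') c0 (le_step_size k s')).
move=> /(tilt_improvement (pi_gt0 k s) (pi_policy k s).2
  (Api_mean0 M _ (pi_policy k)) (ub s) c0 (le_step_size k s)) /le_trans; apply.
rewrite ler_pM2l ?improvement_cost_gt0 //.
under eq_bigr do rewrite -piE.
exact: policy_improvement.
Qed.

Lemma V_le_succ k s : V k s <= V k.+1 s.
Proof.
have [a adv0] := exists_ge0_of_mean0 (pi_gt0 k s) (pi_policy k s).2 (Api_mean0 M s (pi_policy k)).
have pos : 0 <= pi k s a * adv k s a by rewrite pmulr_rge0 ?pi_gt0.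
rewrite -subr_ge0 -(pmulr_rge0 _ improvement_cost_gt0).
by apply: le_trans (one_step_improvement pos); exact: sqr_ge0.
Qed.

Definition Vlim s : R := limn (fun k => V k s).

Lemma V_cvg s : (V k s @[k --> \oo] --> Vlim s)%classic.
Proof.
apply: nondecreasing_is_cvgn.
  by apply/nondecreasing_seqP => k; exact: V_le_succ.
by exists (1 - gamma)^-1 => _ [k _ <-]; have /andP[] := Vpi_bounds M (pi_policy k) s.
Qed.

Lemma Q_cvg s a : (Qpi M (pi k) s a @[k --> \oo] --> backup M Vlim s a)%classic.
Proof.
under eq_cvg do rewrite QpiE //.
apply: cvgD; first exact: cvg_cst.
by apply: cvgMr; apply: cvg_fin_sum => x; apply: cvgMr; exact: V_cvg.
Qed.

Definition advlim s a : R := backup M Vlim s a - Vlim s.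

Lemma adv_cvg s a : (adv k s a @[k --> \oo] --> advlim s a)%classic.
Proof. by apply: cvgB; [exact: Q_cvg | exact: V_cvg]. Qed.

(** One-step improvement bounds the terms from above only. They sum to 0 over the actions, so none
    can be more negative than the others together are positive; hence the factor [#|A|]. *)
Lemma pi_adv_le_sqrt k s a :
  `|pi k s a * adv k s a| <= #|A|%:R * Num.sqrt (improvement_cost * (V k.+1 s - V k s)).
Proof.
set D := improvement_cost * _; have D0 : 0 <= D.
  by apply: mulr_ge0; [exact/ltW/improvement_cost_gt0 | rewrite subr_ge0 V_le_succ].
have ub b : pi k s b * adv k s b <= Num.sqrt D.
  have [/one_step_improvement le_D|/ltW neg] := leP 0 (pi k s b * adv k s b); last first.
    exact: le_trans neg (sqrtr_ge0 _).
  apply: le_trans (ler_norm _) _.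
  by rewrite -sqrtr_sqr; exact: ler_wsqrtr.
have card1 : 1 <= #|A|%:R :> R by rewrite ler1n.
have sD := sqrtr_ge0 D.
rewrite ler_norml; apply/andP; split; last first.
  by apply: le_trans (ub a) _; rewrite ler_peMl.
have : \sum_b (pi k s b * adv k s b - Num.sqrt D) <= pi k s a * adv k s a - Num.sqrt D.
  rewrite (bigD1 a) //= gerDl; apply: sumr_le0 => b _.
  by rewrite subr_le0.
rewrite sumrB Api_mean0 // sumr_const -[Num.sqrt D *+ _]mulr_natl.
lra.
Qed.

Lemma pi_adv_cvg0 s a : (pi k s a * adv k s a @[k --> \oo] --> 0)%classic.
Proof.
have V_diff0 : ((V k.+1 s - V k s) @[k --> \oo] --> 0)%classic.
  rewrite -(subrr (Vlim s)); apply: cvgB; last exact: V_cvg.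
  by have := @V_cvg s; rewrite -cvg_shiftS.
have bound0 :
  (#|A|%:R * Num.sqrt (improvement_cost * (V k.+1 s - V k s)) @[k --> \oo] --> 0)%classic.
  rewrite -[X in (_ --> X)%classic](mulr0 (#|A|%:R : R)); apply: cvgMr.
  rewrite -[X in (_ --> X)%classic](@sqrtr0 R).
  apply: continuous_cvg; first exact: sqrt_continuous.
  by rewrite -[X in (_ --> X)%classic](mulr0 improvement_cost); exact: cvgMr.
apply/cvgr0Pnorm_le => e e0; move/cvgr0Pnorm_le: bound0 => /(_ e e0).
apply: filterS => k; apply: le_trans; apply: le_trans (ler_norm _).
exact: pi_adv_le_sqrt.
Qed.

(** * Global convergence: the limit is the optimal value *)

Lemma advlim_le0 s a : advlim s a <= 0.
Proof.
have [theta [piE thetaS]] := pi_logits.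
apply: (@adv_limit_le0 _ _ (fun k => theta k s) (fun k => pi k s) (fun k => adv k s)
  (fun k => step_size k s) (1 - gamma)^-1 (advlim s)) => [k b|k|k b|k|k b|b|b].
- by rewrite piE.
- by apply: lt_le_trans (le_step_size k s); rewrite mulr_gt0.
- exact: thetaS.
- exact: Api_mean0.
- exact: Api_bounds.
- exact: adv_cvg.
- exact: pi_adv_cvg0.
Qed.

(** Since limiting advantages are nonpositive, [Vlim] dominates its own backup under [pi'], and the
    minimum principle applies to the difference. *)
Lemma Vpi_le_Vlim pi' s : is_policy pi' -> Vpi M pi' s <= Vlim s.
Proof.
move=> pi'_pol; rewrite -subr_ge0.
apply: (bellman_ge0 (discount_bounds M) (policy_kernel_dist M pi'_pol)
  (u := fun x => Vlim x - Vpi M pi' x)) => x.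
rewrite -subr_ge0 [Vpi M pi' x]Vpi_bellman //.
have := @backup_difference _ _ _ M pi' Vlim (Vpi M pi') x pi'_pol.
have : \sum_a pi' x a * (backup M Vlim x a - Vlim x) <= 0.
  by apply: sumr_le0 => a _; rewrite mulr_ge0_le0 ?(pi'_pol x).1 //; exact: advlim_le0.
have -> : \sum_y policy_kernel M pi' x y * (Vpi M pi' y - Vlim y) =
    - \sum_y policy_kernel M pi' x y * (Vlim y - Vpi M pi' y).
  by rewrite -sumrN; apply: eq_bigr => y _; ring.
lra.
Qed.

Lemma V_le_Vlim k s : V k s <= Vlim s.
Proof. exact: Vpi_le_Vlim. Qed.

Lemma VstarE s : Vstar M s = Vlim s.
Proof.
apply: (sup_eq_limit (u := fun k => V k s)) => [_ [pi' pi'_pol <-]|k|].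
- exact: Vpi_le_Vlim.
- by exists (pi k).
- exact: V_cvg.
Qed.

Lemma QstarE s a : Qstar M s a = backup M Vlim s a.
Proof.
apply: (sup_eq_limit (u := fun k => Qpi M (pi k) s a)) => [_ [pi' pi'_pol <-]|k|].
- by rewrite QpiE //; apply: backup_le => x; exact: Vpi_le_Vlim.
- by exists (pi k).
- exact: Q_cvg.
Qed.

Lemma AstarE s a : Astar M s a = advlim s a.
Proof. by rewrite /Astar QstarE VstarE. Qed.

(** * Optimal actions and positivity of [kappa] *)

Lemma advlim_eq0 s : exists a, advlim s a = 0.
Proof.
apply/not_existsP => no.
have neg a : advlim s a < 0 by rewrite lt_neqAle advlim_le0 andbT; apply/eqP; exact: no.
(* If all limits were negative, all advantages would be negative at a common time, against their
   mean 0. *)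
have [k _ adv_lt0] : \forall k \near \oo%classic, forall a, adv k s a < 0.
  by apply: filter_forall => a; exact: (cvgr_lt _ (@adv_cvg s a)).
have [a] := exists_ge0_of_mean0 (pi_gt0 k s) (pi_policy k s).2 (Api_mean0 M s (pi_policy k)).
by rewrite leNgt adv_lt0 /=.
Qed.

Lemma opt_actionsE s a : (a \in opt_actions M s) = (advlim s a == 0).
Proof.
rewrite inE; apply/forallP/eqP => [opt|a0 b].
  have [b b0] := advlim_eq0 s.
  by apply/eqP; rewrite eq_le advlim_le0 -b0 -!AstarE opt.
by rewrite !AstarE a0 advlim_le0.
Qed.

(** For a suboptimal action the product of probability and advantage tends to 0 while the advantage
    has a nonzero limit. *)
Lemma subopt_mass_cvg0 s : (subopt_mass M (pi k) s @[k --> \oo] --> 0)%classic.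
Proof.
have -> : (0 : R) = \sum_(a | a \notin opt_actions M s) 0 by rewrite big1.
apply: cvg_big => [|a]; first exact: add_continuous.
rewrite opt_actionsE => La.
have adv_lim := @adv_cvg s a.
have : (pi k s a * adv k s a * (adv k s a)^-1 @[k --> \oo] --> 0 * (advlim s a)^-1)%classic.
  by apply: cvgM; [exact: pi_adv_cvg0 | exact: cvgV].
rewrite mul0r; apply: cvg_trans; apply: near_eq_cvg.
have : advlim s a < 0 by rewrite lt_neqAle La advlim_le0.
move=> /(cvgr_lt _ adv_lim); apply: filterS => k adv_neg.
by rewrite mulfK // lt_eqF.
Qed.

Lemma one_sub_subopt_mass k s : 1 - subopt_mass M (pi k) s = \sum_(a in opt_actions M s) pi k s a.
Proof. by rewrite -(pi_policy k s).2 (bigID (mem (opt_actions M s))) /= addrK. Qed.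

Lemma opt_mass_gt0 k s : 0 < 1 - subopt_mass M (pi k) s.
Proof.
rewrite one_sub_subopt_mass; have [a a0] := advlim_eq0 s.
rewrite (bigD1 a) /=; last by rewrite opt_actionsE a0.
by rewrite ltr_pwDl ?pi_gt0 // sumr_ge0 // => b _; exact/ltW/pi_gt0.
Qed.

Lemma min_opt_mass_gt0 k : 0 < min_entry (fun s => 1 - subopt_mass M (pi k) s).
Proof. by apply: lt_bigmin => // s _; exact: opt_mass_gt0. Qed.

Lemma kappa_le k s : kappa M pi <= 1 - subopt_mass M (pi k) s.
Proof.
apply: (@le_trans _ _ (min_entry (fun s => 1 - subopt_mass M (pi k) s))).
  apply: ge_inf; last by exists k.
  by exists 0 => _ [j _ <-]; exact/ltW/min_opt_mass_gt0.
exact: bigmin_le.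
Qed.

(* Optimal mass tends to 1 and is positive at every step, so it stays away from 0. *)
Lemma kappa_gt0 : 0 < kappa M pi.
Proof.
have [N _ half] : \forall k \near \oo%classic, forall s, subopt_mass M (pi k) s < 1/2.
  apply: filter_forall => s; apply: (cvgr_lt _ (@subopt_mass_cvg0 s)); lra.
pose d k := min_entry (fun s => 1 - subopt_mass M (pi k) s).
pose m := \big[Num.min/1/2]_(k < N) d k.
have m0 : 0 < m.
  by apply: lt_bigmin => [|k _]; [rewrite divr_gt0 | exact: min_opt_mass_gt0].
apply: lt_le_trans m0 _; apply: lb_le_inf; first by exists (d 0%N), 0%N.
move=> _ [k _ <-]; have [kN|Nk] := ltnP k N.
  exact: (bigmin_le _ (Ordinal kN)).
apply: le_trans (bigmin_le_id _ _ _ _) _.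
(* The default value 1 of [min_entry] is compared with 1/2 as well as the entries. *)
by apply/bigmin_geP; split=> [|s _]; [|have := half k Nk s]; lra.
Qed.

(** * Comparison with policies supported on the optimal actions *)

Lemma gap_bellman q k s : is_policy q -> (forall a, a \notin opt_actions M s -> q s a = 0) ->
  Vlim s - V k s = \sum_a q s a * adv k s a +
    gamma * \sum_x policy_kernel M q s x * (Vlim x - V k x).
Proof.
move=> q_pol q_opt.
have := @backup_difference _ _ _ M q (V k) Vlim s q_pol.
under [in RHS]eq_bigr do rewrite -ApiE //.
move=> <-; congr (_ - _).
(* At optimal actions the backup of [Vlim] is [Vlim] itself, and [q] charges no others. *)
rewrite -[LHS]mul1r -(q_pol s).2 mulr_suml; apply: eq_bigr => a _.
have [|/q_opt ->] := boolP (a \in opt_actions M s); last by rewrite !mul0r.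
by rewrite opt_actionsE subr_eq0 => /eqP ->.
Qed.

Definition opt_restriction k s a : R :=
  if a \in opt_actions M s then pi k s a / (1 - subopt_mass M (pi k) s) else 0.

Lemma opt_restriction_policy k : is_policy (opt_restriction k).
Proof.
move=> s; split=> [a|].
  rewrite /opt_restriction; case: ifP => // _; apply: mulr_ge0; first exact/ltW/pi_gt0.
  by rewrite invr_ge0; exact/ltW/opt_mass_gt0.
rewrite /opt_restriction -big_mkcond /= -mulr_suml -one_sub_subopt_mass divff //.
by rewrite gt_eqF // opt_mass_gt0.
Qed.

Definition opt_adv k s : R := \sum_a opt_restriction k s a * adv k s a.

(** The optimal mass, at least [kappa], times [opt_adv] is a sum of [pi * adv] over the optimal
    actions, so at most their number times its largest term. The positive part is taken because a
    negative mean says nothing about improvement. *)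
Lemma opt_adv_improvement k s :
  (kappa M pi * Num.max (opt_adv k s) 0) ^+ 2 <=
  #|opt_actions M s|%:R ^+ 2 * (improvement_cost * (V k.+1 s - V k s)).
Proof.
have cost0 := improvement_cost_gt0.
have [x0|x0] := leP (opt_adv k s) 0.
  rewrite mulr0 expr0n /= mulr_ge0 ?sqr_ge0 // mulr_ge0 ?(ltW cost0) //.
  by rewrite subr_ge0 V_le_succ.
pose o := 1 - subopt_mass M (pi k) s.
have o0 : 0 < o by exact: opt_mass_gt0.
have oxE : o * opt_adv k s = \sum_(a in opt_actions M s) pi k s a * adv k s a.
  rewrite [RHS]big_mkcond mulr_sumr; apply: eq_bigr => a _.
  rewrite /opt_restriction; case: ifP => _; last by rewrite mul0r mulr0.
  by rewrite mulrA mulrCA divff ?mulr1 // gt_eqF.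
have [a aopt] : exists a, a \in opt_actions M s.
  by have [a a0] := advlim_eq0 s; exists a; rewrite opt_actionsE a0.
have [b _ bmax] := @Order.TotalTheory.arg_maxP _ R A a
  (mem (opt_actions M s)) (fun a => pi k s a * adv k s a) aopt.
set v := pi k s b * adv k s b in bmax.
have ox_le : o * opt_adv k s <= #|opt_actions M s|%:R * v.
  by rewrite oxE mulr_natl -sumr_const; apply: ler_sum => c; exact: bmax.
have ox0 : 0 < o * opt_adv k s by rewrite mulr_gt0.
have v0 : 0 <= v.
  rewrite leNgt; apply/negP => v_neg.
  have : #|opt_actions M s|%:R * v <= 0 by rewrite mulr_ge0_le0 // ltW.
  lra.
apply: (@le_trans _ _ ((#|opt_actions M s|%:R * v) ^+ 2)).
  rewrite ler_sqr ?nnegrE; last by rewrite mulr_ge0.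
    apply: le_trans ox_le; rewrite ler_pM2r //; exact: kappa_le.
  by rewrite mulr_ge0 // ltW // kappa_gt0.
by rewrite exprMn; apply: ler_wpM2l; [exact: sqr_ge0 | exact: one_step_improvement].
Qed.

(** The constant [m / (1 - gamma)] solves the evaluation equation with reward [m], which dominates
    that of the gap. *)
Lemma gap_le k m s : (forall x, opt_adv k x <= m) -> Vlim s - V k s <= m / (1 - gamma).
Proof.
move=> le_m; rewrite -subr_ge0.
have c0 := one_minus_discount_gt0 M.
apply: (bellman_ge0 (discount_bounds M) (policy_kernel_dist M (opt_restriction_policy k))
  (u := fun x => m / (1 - gamma) - (Vlim x - V k x))) => x.
rewrite [X in _ <= _ - X](gap_bellman k (opt_restriction_policy k)); last first.
  by move=> a /negPf aopt; rewrite /opt_restriction aopt.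
under eq_bigr do rewrite mulrBr.
rewrite sumrB -mulr_suml (policy_kernel_dist M (opt_restriction_policy k) x).2 mul1r.
have := le_m x; rewrite -/(opt_adv k x) => lex.
have : m / (1 - gamma) = m + gamma * (m / (1 - gamma)) by field; lra.
lra.
Qed.

(** The limiting advantages are nonpositive and have mean 0 under [q], so each term of the mean
    vanishes. *)
Lemma optimal_policy_support q s a : optimal_policy M q ->
  a \notin opt_actions M s -> q s a = 0.
Proof.
move=> [q_pol q_opt]; rewrite opt_actionsE => /negPf La0.
have qE : Vpi M q = Vlim by apply/funext => x; rewrite q_opt VstarE.
have sum0 : \sum_b - (q s b * advlim s b) = 0.
  rewrite sumrN /advlim; under eq_bigr do rewrite mulrBr.
  rewrite sumrB -mulr_suml (q_pol s).2 mul1r -qE -Vpi_bellman // subrr oppr0.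
  by [].
have nonneg b : true -> 0 <= - (q s b * advlim s b).
  by move=> _; rewrite oppr_ge0 mulr_ge0_le0 ?(q_pol s).1 // advlim_le0.
have /eqP := psumr_eq0P nonneg sum0 (i := a) isT.
by rewrite oppr_eq0 mulf_eq0 La0 orbF => /eqP.
Qed.

(** * The rates of order [1 / k] *)

Section Rate.
Variable rho : S -> R.
Hypothesis rho_dist : is_dist rho.
Hypothesis rho_min : 0 < min_entry rho.

Local Notation gap k := (avg rho (Vstar M) - avg rho (V k)).

Lemma gapE k : gap k = \sum_s rho s * (Vlim s - V k s).
Proof. by rewrite /avg -sumrB; apply: eq_bigr => s _; rewrite VstarE mulrBr. Qed.

Lemma gap_ge0 k : 0 <= gap k.
Proof.
rewrite gapE; apply: sumr_ge0 => s _; rewrite mulr_ge0 ?rho_dist.1 //.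
by rewrite subr_ge0 V_le_Vlim.
Qed.

Lemma gap_decrease k : gap k - gap k.+1 = \sum_s rho s * (V k.+1 s - V k s).
Proof. by rewrite !gapE -sumrB; apply: eq_bigr => s _; ring. Qed.

(** Only the state [t] of largest [opt_adv] is used: it bounds the gap in all states, and its
    improvement alone lowers the gap by at least [min_entry rho] times that improvement. *)
Lemma gap_rate k : (0 < k)%N ->
  gap k <= (\max_s #|opt_actions M s|)%:R ^+ 2 * improvement_cost /
    (min_entry rho * (1 - gamma) ^+ 2 * kappa M pi ^+ 2) / k%:R.
Proof.
have c0 := one_minus_discount_gt0 M.
have kap0 := kappa_gt0.
have cost0 := improvement_cost_gt0.
have [s0 _] : exists s : S, True.
  apply/not_existsP => noS; have := rho_dist.2; rewrite big1 => [|s]; last by case: (noS s).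
  by move/eqP; rewrite eq_sym oner_eq0.
set m := \max_s _.
have m0 : 0 < m%:R :> R.
  rewrite ltr0n; apply: leq_trans (leq_bigmax s0).
  by have [a a0] := advlim_eq0 s0; apply/card_gt0P; exists a; rewrite opt_actionsE a0.
have rho0 := rho_min.
move: k; apply: (quadratic_recursion_rate (E := fun k => gap k)) => [|k].
  by rewrite divr_gt0 ?mulr_gt0 ?exprn_gt0.
have [t _ tmax] := @Order.TotalTheory.arg_maxP _ R S s0 xpredT (opt_adv k) isT.
set y := Num.max (opt_adv k t) 0.
have y0 : 0 <= y by rewrite le_max lexx orbT.
have gap_y : (gap k) ^+ 2 <= (y / (1 - gamma)) ^+ 2.
  rewrite ler_sqr ?nnegrE ?gap_ge0 ?divr_ge0 ?(ltW c0) // gapE.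
  apply: ler_wsum_const => // s; apply: gap_le => x.
  by rewrite le_max; apply/orP; left; exact: tmax.
have drop : min_entry rho * (V k.+1 t - V k t) <= gap k - gap k.+1.
  rewrite gap_decrease (bigD1 t) //=; apply: ler_wpDr.
    by apply: sumr_ge0 => s _; rewrite mulr_ge0 ?rho_dist.1 // subr_ge0 V_le_succ.
  by rewrite ler_wpM2r ?subr_ge0 ?V_le_succ //; exact: bigmin_le.
have impr : (kappa M pi * y) ^+ 2 <= m%:R ^+ 2 * (improvement_cost * (V k.+1 t - V k t)).
  apply: le_trans (opt_adv_improvement k t) _; apply: ler_wpM2r.
    by rewrite mulr_ge0 ?(ltW cost0) // subr_ge0 V_le_succ.
  by rewrite ler_sqr ?nnegrE // ler_nat leq_bigmax.
apply: le_trans gap_y _.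
rewrite mulrAC ler_pdivlMr ?mulr_gt0 ?exprn_gt0 //.
have -> : (y / (1 - gamma)) ^+ 2 * (min_entry rho * (1 - gamma) ^+ 2 * kappa M pi ^+ 2) =
  min_entry rho * (kappa M pi * y) ^+ 2 by field; lra.
apply: (@le_trans _ _ (min_entry rho * (m%:R ^+ 2 * (improvement_cost * (V k.+1 t - V k t))))).
  by rewrite ler_pM2l.
have -> : min_entry rho * (m%:R ^+ 2 * (improvement_cost * (V k.+1 t - V k t))) =
  m%:R ^+ 2 * improvement_cost * (min_entry rho * (V k.+1 t - V k t)) by ring.
by rewrite ler_pM2l // mulr_gt0 ?exprn_gt0.
Qed.

(** Here the comparison policy is [q] at every step, so the gap is an average of [opt_adv] under one
    fixed visitation measure. Its square is bounded by convexity, and the density with respect to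
    [rho] converts the result into the decrease of the gap. *)
Lemma gap_rate_unique q k : (forall s, #|opt_actions M s| = 1%N) -> optimal_policy M q ->
  (0 < k)%N ->
  gap k <= norm_oo (fun s => visitation M q rho s / rho s) * improvement_cost /
    ((1 - gamma) ^+ 2 * kappa M pi ^+ 2) / k%:R.
Proof.
move=> opt1 q_opt; have q_pol := q_opt.1.
have c0 := one_minus_discount_gt0 M.
have kap0 := kappa_gt0.
have cost0 := improvement_cost_gt0.
set N := norm_oo _.
have rho0 s : 0 < rho s by apply: lt_le_trans rho_min _; exact: bigmin_le.
have d_dist : is_dist (visitation M q rho).
  by split=> [s|]; [exact: visitation_ge0 | exact: sum_visitation1].
have d_le s : visitation M q rho s <= N * rho s.
  rewrite -ler_pdivrMr //; apply: le_trans (ler_norm _) _.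
  exact: (le_bigmax _ (fun s => `|visitation M q rho s / rho s|)).
have N0 : 0 < N.
  (* Both the visitation measure and [rho] have total mass 1. *)
  have : 1 <= N.
    rewrite -d_dist.2 -[leRHS]mulr1 -rho_dist.2 mulr_sumr.
    by apply: ler_sum => s _; exact: d_le.
  lra.
move: k; apply: (quadratic_recursion_rate (E := fun k => gap k)) => [|k].
  by rewrite divr_gt0 ?mulr_gt0 ?exprn_gt0.
have qE s a : q s a = opt_restriction k s a.
  have /cards1P[b optE] : #|opt_actions M s| == 1%N by rewrite opt1.
  have [q_off r_off] : (forall c, c != b -> q s c = 0) /\
      (forall c, c != b -> opt_restriction k s c = 0).
    split=> c cb; first by apply: optimal_policy_support; rewrite // optE inE.
    by rewrite /opt_restriction optE inE (negPf cb).
  have [->|ab] := eqVneq a b; last by rewrite q_off // r_off.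
  by rewrite (dist_on_singleton (q_pol s) q_off)
    (dist_on_singleton (opt_restriction_policy k s) r_off).
have gap_visit : (1 - gamma) * gap k = \sum_s visitation M q rho s * opt_adv k s.
  rewrite gapE; apply: sum_visitation => // s.
  rewrite (gap_bellman k q_pol) => [|a]; last exact: optimal_policy_support.
  by congr (_ + _); apply: eq_bigr => a _; rewrite qE.
pose y s := Num.max (opt_adv k s) 0.
have gap_y : ((1 - gamma) * gap k) ^+ 2 <= \sum_s visitation M q rho s * y s ^+ 2.
  apply: le_trans (sqr_avg_le y d_dist).
  have le_y : (1 - gamma) * gap k <= \sum_s visitation M q rho s * y s.
    rewrite gap_visit; apply: ler_sum => s _; apply: ler_wpM2l; first exact: d_dist.1.
    by rewrite le_max lexx.
  rewrite ler_sqr ?nnegrE //; last first.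
    by apply: le_trans le_y; rewrite mulr_ge0 ?gap_ge0 // ltW.
  by rewrite mulr_ge0 ?gap_ge0 // ltW.
rewrite mulrAC ler_pdivlMr ?mulr_gt0 ?exprn_gt0 //.
apply: (@le_trans _ _ (kappa M pi ^+ 2 * \sum_s visitation M q rho s * y s ^+ 2)).
  rewrite [leLHS](_ : _ = kappa M pi ^+ 2 * ((1 - gamma) * gap k) ^+ 2); last by ring.
  by rewrite ler_pM2l ?exprn_gt0.
rewrite gap_decrease !mulr_sumr; apply: ler_sum => s _.
rewrite mulrCA -exprMn.
apply: (@le_trans _ _ (N * rho s * (kappa M pi * y s) ^+ 2)).
  by apply: ler_wpM2r; [exact: sqr_ge0 | exact: d_le].
rewrite -!mulrA ler_pM2l // [leRHS]mulrCA ler_pM2l //.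
by have := opt_adv_improvement k s; rewrite opt1 expr1n mul1r.
Qed.

End Rate.
End Sequence.

Theorem theorem4p5 (R : realType) (S A : finType) (hA : (0 < #|A|)%N)
  (M : mdp R S A)
  (mu : S -> R) (hmu : is_dist mu) (hmu0 : 0 < min_entry mu)
  (rho : S -> R) (hrho : is_dist rho) (hrho0 : 0 < min_entry rho)
  (eta : R) (heta : 0 < eta)
  (pi : nat -> S -> A -> R)
  (hpi : generated_by_softmax_pg M mu (fun=> eta) pi) :
  (forall k : nat, (1 <= k)%N ->
     avg rho (Vstar M) - avg rho (Vpi M (pi k)) <=
       1 / k%:R * (1 / (min_entry rho * (1 - discount M) ^+ 3)) *
       (#|A|%:R / kappa M pi ^+ 2) *
       (\max_s #|opt_actions M s|)%:R ^+ 2 *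
       (1 + (1 - discount M) / (eta * min_entry mu))) /\
  ((forall s, #|opt_actions M s| = 1%N) ->
   forall pistar : S -> A -> R, optimal_policy M pistar ->
   forall k : nat, (1 <= k)%N ->
     avg rho (Vstar M) - avg rho (Vpi M (pi k)) <=
       1 / k%:R * (1 / (1 - discount M) ^+ 3) *
       (#|A|%:R / kappa M pi ^+ 2) *
       norm_oo (fun s => visitation M pistar rho s / rho s) *
       (1 + (1 - discount M) / (eta * min_entry mu))).
Proof.
have c0 := one_minus_discount_gt0 M.
have kap0 := kappa_gt0 hA hmu hmu0 heta hpi.
have card1 : 1 <= #|A|%:R :> R by rewrite ler1n.
(* The rates above lack the factor [#|A|], which is at least 1. *)
have weaken (x B : R) : 0 <= x -> x <= B -> x <= #|A|%:R * B.
  move=> x0 xB; apply: (le_trans xB); rewrite ler_peMl //; exact: le_trans xB.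
have e0 : eta != 0 by rewrite gt_eqF.
have mu0 : min_entry mu != 0 by rewrite gt_eqF.
have r0 : min_entry rho != 0 by rewrite gt_eqF.
have g0 : 1 - discount M != 0 by rewrite gt_eqF.
have ka0 : kappa M pi != 0 by rewrite gt_eqF.
split=> [k k0|opt1 q q_opt k k0]; have kn0 : k%:R != 0 :> R by rewrite pnatr_eq0 -lt0n.
  apply: le_trans (weaken _ _ (gap_ge0 hA hmu hmu0 heta hpi hrho k)
    (gap_rate hA hmu hmu0 heta hpi hrho hrho0 k0)) _.
  (* Equality holds: factoring [(1 - gamma)^-1] out of [improvement_cost] gives the last factor and
     the third power of [1 - gamma]. *)
  rewrite le_eqVlt; apply/orP; left; apply/eqP; rewrite /improvement_cost; field.
  by rewrite e0 mu0 r0 g0 ka0 kn0.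
apply: le_trans (weaken _ _ (gap_ge0 hA hmu hmu0 heta hpi hrho k)
  (gap_rate_unique hA hmu hmu0 heta hpi hrho hrho0 opt1 q_opt k0)) _.
rewrite le_eqVlt; apply/orP; left; apply/eqP; rewrite /improvement_cost; field.
by rewrite e0 mu0 g0 ka0 kn0.
Qed.
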